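(* Let $0<\alpha<1$. Then there exists a function $f\in\Lambda_\alpha(\mathbb{R})$ such that at almost every $x\in\mathbb{R}$ (with respect to Lebesgue measure) one has $$\limsup_{h\to0^+}\Delta_\alpha(f)(x,h)>0\qquad\text{and}\qquad \liminf_{h\to0^+}\Delta_\alpha(f)(x,h)=0.$$
   Context: For $0<\alpha<1$, $\Lambda_\alpha(\mathbb{R})$ is the class of functions $f:\mathbb{R}\to\mathbb{R}$ for which there is a constant $C=C(f)>0$ with $|f(x)-f(y)|\le C|x-y|^\alpha$ for all $x,y\in\mathbb{R}$. The $\alpha$-divided difference is $\Delta_\alpha(f)(x,h)=\dfrac{f(x+h)-f(x)}{|h|^\alpha}$. *)

(* Defs.v *)
From HB Require Import structures.
From mathcomp Require Import all_boot all_order all_algebra.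
From mathcomp Require Import all_classical all_reals all_analysis.

Set Implicit Arguments.
Unset Strict Implicit.
Unset Printing Implicit Defensive.

Import Order.TTheory GRing.Theory Num.Theory.
Import numFieldNormedType.Exports.

Local Open Scope classical_set_scope.
Local Open Scope ring_scope.

Definition holder_class (R : realType) (alpha : R) : set (R -> R) :=
  [set f | exists2 C : R, 0 < C &
    forall x y : R, `|f x - f y| <= C * `|x - y| `^ alpha].

(* The value at h = 0 is irrelevant: limits as h -> 0+ use the filter 0^'+,
   which only sees h > 0. *)
Definition divided_difference (R : realType) (alpha : R) (f : R -> R)
  (x h : R) : R := (f (x + h) - f x) / `|h| `^ alpha.

(* Main.v *)
(* Let f be a sum of teeth: the n-th tooth has period d_n, and on each period it
   rises from 0 to l_n^alpha on an initial interval of length 2 l_n, then falls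
   slowly back to 0, where l_n = d_n / (n + 4), and d_(n+1) divides l_n and is
   much smaller, so that coarser teeth are nearly constant at scale d_n.  The
   falls have slope of order l_n^alpha / d_n = o(d_n^(alpha - 1)), so they are
   invisible to the divided differences and the lower limit is >= 0 everywhere.
   It is <= 0 everywhere because a shift by d_n preserves the teeth m >= n.
   Points in the first half of a rise at level n gain about l_n^alpha / 2 under a
   shift by l_n.  These points have density 1/(n + 4), independently over the
   levels, and sum 1/(n + 4) diverges, so almost every x is such a point for
   infinitely many n. *)
Require Import Defs.
From HB Require Import structures.
From mathcomp Require Import all_boot all_order all_algebra.
From mathcomp Require Import all_classical all_reals all_analysis.
From mathcomp Require Import ring lra.

Import Order.TTheory GRing.Theory Num.Theory.
Import numFieldNormedType.Exports.

Local Open Scope classical_set_scope.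
Local Open Scope ring_scope.

Set Implicit Arguments.
Unset Strict Implicit.
Unset Printing Implicit Defensive.

(** * A one-periodic sawtooth with a short rise and a long fall *)

Section Tent.
Context {R : realType}.
Implicit Types (p s t u v : R) (F : R -> R).

Definition frac t : R := t - (Num.floor t)%:~R.

Lemma frac_ge0 t : 0 <= frac t.
Proof. by rewrite subr_ge0; have /andP[] := floor_itv t. Qed.

Lemma frac_lt1 t : frac t < 1.
Proof. by rewrite ltrBlDl -intrD1; have /andP[] := floor_itv t. Qed.

Lemma fracDn t (k : nat) : frac (t + k%:R) = frac t.
Proof.
have kz : (k%:R : R) \is a Num.int by apply/intrP; exists k.
by rewrite /frac floorDrz// intrD (floorK kz) opprD addrACA subrr addr0.
Qed.

Lemma frac_id (k : int) t : k%:~R <= t < k%:~R + 1 -> frac t = t - k%:~R.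
Proof. by move=> kt; rewrite /frac (@floor_def _ _ k)// intrD. Qed.

(** If [s] and [t] lie in different unit cells, go from [s] up to the end of its cell and from the
    start of the cell of [t] to [t]. The values at the two ends cancel by [F 0 = F 1], and the
    length covered is at most [t - s]. *)
Lemma slope_frac F (K : R) : 0 <= K -> F 0 = F 1 ->
  (forall u v, 0 <= u -> u <= v -> v <= 1 -> F v - F u <= K * (v - u)) ->
  forall s t, s <= t -> F (frac t) - F (frac s) <= K * (t - s).
Proof.
move=> K0 F01 slopeF s t st.
have s0 := frac_ge0 s; have t0 := frac_ge0 t.
have s1 := ltW (frac_lt1 s); have t1 := ltW (frac_lt1 t).
have := le_floor st; rewrite le_eqVlt => /orP[/eqP E|].
  have e : frac t - frac s = t - s by rewrite /frac E; ring.
  by rewrite -e slopeF// -subr_ge0 e subr_ge0.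
rewrite -lezD1 -(ler_int R) intrD => lt_floor.
have h1 := slopeF _ _ (lexx 0) t0 t1.
have h2 := slopeF _ _ s0 s1 (lexx 1).
have : K * (frac t + 1 - frac s) <= K * (t - s).
  by apply: ler_wpM2l => //; rewrite /frac; lra.
lra.
Qed.

(** On the unit interval this is the tent with apex 1 at [2 * p]. As a minimum of two lines it obeys
    its slope bounds on all of [R], by comparing the lines. *)
Definition tent p u : R := Num.min (u / (2 * p)) ((1 - u) / (1 - 2 * p)).

Definition saw p t : R := tent p (frac t).

Variable p : R.
Hypotheses (p0 : 0 < p) (p4 : p <= 4^-1).

Local Notation rise := ((2 * p)^-1).
Local Notation fall := ((1 - 2 * p)^-1).

(** All follow from [1 - 2 * p >= 2^-1 >= p], a consequence of [p <= 4^-1]. *)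
Let slopes : [/\ 0 < rise, 0 < fall, rise <= p^-1, fall <= p^-1 & fall <= 2].
Proof.
have p0' := p0; have p4' := p4.
split; [rewrite invr_gt0|rewrite invr_gt0|rewrite lef_pV2 ?posrE
  |rewrite lef_pV2 ?posrE|rewrite invf_ple ?posrE]; lra.
Qed.

Let tentE u : tent p u = Num.min (u * rise) ((1 - u) * fall).
Proof. by []. Qed.

Lemma tent01 : tent p 0 = tent p 1.
Proof.
have p0' := p0; have p4' := p4.
have [rise_gt0 fall_gt0 rise_le fall_le fall_le2] := slopes.
rewrite !tentE subrr subr0 !mul0r !mul1r.
by rewrite min_l ?min_r // ltW.
Qed.

Lemma tent_slope_ub u v : u <= v -> tent p v - tent p u <= p^-1 * (v - u).
Proof.
have p0' := p0; have p4' := p4.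
have [rise_gt0 fall_gt0 rise_le fall_le fall_le2] := slopes.
move=> uv; rewrite !tentE.
have h1 : rise * (v - u) <= p^-1 * (v - u) by rewrite ler_wpM2r// subr_ge0.
have h2 : 0 <= fall * (v - u) by rewrite mulr_ge0 ?subr_ge0// ltW.
have h3 : 0 <= rise * (v - u) by rewrite mulr_ge0 ?subr_ge0// ltW.
rewrite /Num.min; case: ltP => a; case: ltP => b; lra.
Qed.

Lemma tent_slope_lb u v : u <= v -> tent p u - tent p v <= fall * (v - u).
Proof.
have p0' := p0; have p4' := p4.
have [rise_gt0 fall_gt0 rise_le fall_le fall_le2] := slopes.
move=> uv; rewrite !tentE.
have h2 : 0 <= fall * (v - u) by rewrite mulr_ge0 ?subr_ge0// ltW.
have h3 : 0 <= rise * (v - u) by rewrite mulr_ge0 ?subr_ge0// ltW.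
rewrite /Num.min; case: ltP => a; case: ltP => b; lra.
Qed.

Lemma saw_ge0 t : 0 <= saw p t.
Proof.
have p0' := p0; have p4' := p4.
have [rise_gt0 fall_gt0 rise_le fall_le fall_le2] := slopes.
have t0 := frac_ge0 t; have t1 := frac_lt1 t.
have t1' : 0 <= 1 - frac t by rewrite subr_ge0 ltW.
rewrite /saw tentE le_min (mulr_ge0 t0 (ltW rise_gt0)).
by rewrite (mulr_ge0 t1' (ltW fall_gt0)).
Qed.

Lemma saw_le1 t : saw p t <= 1.
Proof.
have p0' := p0; have p4' := p4.
have t0 := frac_ge0 t; have t1 := frac_lt1 t.
rewrite /saw /tent; case: (leP (frac t) (2 * p)) => h.
  by rewrite ge_min ler_pdivrMr ?mul1r ?h//; lra.
by rewrite ge_min [X in _ || X]ler_pdivrMr ?mul1r; [apply/orP; right|]; lra.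
Qed.

Lemma sawDn t (k : nat) : saw p (t + k%:R) = saw p t.
Proof. by rewrite /saw fracDn. Qed.

(** The bound on the descent is uniform in [p], although the ascent steepens as [p] shrinks. Apply
    [slope_frac] to the negated tent. *)
Lemma saw_fall s t : s <= t -> saw p s - saw p t <= 2 * (t - s).
Proof.
have p0' := p0; have p4' := p4.
have [rise_gt0 fall_gt0 rise_le fall_le fall_le2] := slopes.
move=> st; rewrite /saw -opprB lerNl -mulNr.
have := @slope_frac (fun u => - tent p u) 2 _ _ _ s t st.
rewrite opprK addrC => h; rewrite -lerN2 mulNr !opprK.
rewrite opprB; apply: h => //.
  by rewrite tent01.
move=> u v _ uv _; rewrite opprK addrC (le_trans (tent_slope_lb uv))//.
by rewrite ler_wpM2r// subr_ge0.
Qed.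

Lemma saw_lipschitz s t : `|saw p t - saw p s| <= p^-1 * `|t - s|.
Proof.
have p0' := p0; have p4' := p4.
have [rise_gt0 fall_gt0 rise_le fall_le fall_le2] := slopes.
wlog st : s t / s <= t.
  move=> H; case: (leP s t) => st; first exact: H.
  by rewrite distrC [X in _ * X]distrC H// ltW.
have pV : 0 <= p^-1 by rewrite invr_ge0 ltW.
rewrite (ger0_norm (x := t - s)) ?subr_ge0// ler_norml; apply/andP; split.
  have -> : saw p t - saw p s = - (- saw p t - - saw p s) by ring.
  rewrite lerN2; apply: (@slope_frac (fun u => - tent p u)) => //.
    by rewrite tent01.
  move=> u v _ uv _; rewrite opprK addrC (le_trans (tent_slope_lb uv))//.
  by rewrite ler_wpM2r// subr_ge0.
apply: slope_frac => //; first exact: tent01.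
by move=> u v _ uv _; exact: tent_slope_ub.
Qed.

(** Both points lie on the rising line, whose slope is [(2 * p)^-1]. *)
Lemma saw_rise (k : int) t : k%:~R <= t < k%:~R + p ->
  saw p (t + p) - saw p t = 2^-1.
Proof.
have p0' := p0; have p4' := p4.
move=> /andP[kt tk].
rewrite /saw (@frac_id k) ?(@frac_id k); [|apply/andP; split; lra..].
have tentl u : 0 <= u -> u <= 2 * p -> tent p u = u / (2 * p).
  move=> u0 up; rewrite /tent min_l// (@le_trans _ _ 1)//.
    by rewrite ler_pdivrMr; lra.
  by rewrite ler_pdivlMr; lra.
rewrite !tentl; [field; lra|lra..].
Qed.

End Tent.

(** * The scales of the construction and their sizes *)

Section Scales.
Context {R : realType}.
Variable alpha : R.
Hypotheses (alpha0 : 0 < alpha) (alpha1 : alpha < 1).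
Implicit Types (h x y : R) (m n k : nat).

Lemma powR_split h : 0 < h -> h = h `^ alpha * h `^ (1 - alpha).
Proof.
move=> h0; rewrite -powRD; last by rewrite (gt_eqF h0) implybT.
by rewrite addrC subrK powRr1// ltW.
Qed.

(** The chord of a concave power lies below its graph; here this is read off from monotonicity of
    the power [1 - alpha]. *)
Lemma powR_slope a h : 0 < h -> h <= a -> a `^ alpha / a * h <= h `^ alpha.
Proof.
move=> h0 ha; have a0 : 0 < a by exact: lt_le_trans ha.
rewrite mulrAC ler_pdivrMr// [X in _ * X <= _](powR_split h0).
rewrite [X in _ <= _ * X](powR_split a0) mulrCA ler_wpM2l ?powR_ge0//.
rewrite ler_wpM2l ?powR_ge0// ge0_ler_powR ?nnegrE ?(ltW h0) ?(ltW a0)//.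
by rewrite subr_ge0 ltW.
Qed.

Definition ratio n : R := (n + 4)%:R^-1.

(** The first summand makes the power [1 - alpha] of [refine n] at least [2 * (n + 5)], which tames
    the slopes of coarser teeth. The second makes its power [alpha] at least 2, so that heights at
    least halve. *)
Definition refine n : nat :=
  (Num.truncn ((2 * (n + 5)%:R) `^ (1 - alpha)^-1 + 2 `^ alpha^-1 : R)).+1.

Fixpoint period n : R :=
  if n is m.+1 then ratio m * period m / (refine m)%:R else 1.

Definition rise_width n : R := ratio n * period n.

Definition height n : R := rise_width n `^ alpha.

Definition tooth n x : R := height n * saw (ratio n) (x / period n).

(** A Lipschitz constant for the sum of the teeth coarser than level [n]. *)
Definition slope_sum n : R := \sum_(0 <= m < n) height m / rise_width m.

Lemma ratio_gt0 n : 0 < ratio n.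
Proof. by rewrite invr_gt0 ltr0n addn4. Qed.

Lemma ratio_le n : ratio n <= 4^-1.
Proof. by rewrite lef_pV2 ?posrE ?ltr0n ?addn4// ler_nat. Qed.

Lemma refine_gt n :
  (2 * (n + 5)%:R) `^ (1 - alpha)^-1 + 2 `^ alpha^-1 < (refine n)%:R :> R.
Proof. exact: truncnS_gt. Qed.

Lemma refine_gt0 n : 0 < (refine n)%:R :> R.
Proof. by rewrite ltr0n. Qed.

Lemma refine_powR n : 2 <= (refine n)%:R `^ alpha :> R.
Proof.
have -> : 2 = (2 `^ alpha^-1) `^ alpha :> R.
  by rewrite -powRrM mulVf ?gt_eqF// powRr1.
rewrite ge0_ler_powR ?nnegrE ?powR_ge0 ?(ltW alpha0) ?(ltW (refine_gt0 n))//.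
rewrite (le_trans _ (ltW (refine_gt n)))//.
by rewrite lerDr powR_ge0.
Qed.

Lemma refine_slope n :
  2 * (refine n)%:R `^ alpha / (refine n)%:R <= ratio n.+1 :> R.
Proof.
have q0 := refine_gt0 n.
have qa : 0 < (refine n)%:R `^ alpha :> R by rewrite powR_gt0.
have qb : 2 * (n + 5)%:R <= (refine n)%:R `^ (1 - alpha) :> R.
  have -> : 2 * (n + 5)%:R =
      ((2 * (n + 5)%:R) `^ (1 - alpha)^-1) `^ (1 - alpha) :> R.
    rewrite -powRrM mulVf ?powRr1 ?mulr_ge0 ?ler0n//.
    by rewrite gt_eqF ?subr_gt0.
  rewrite ge0_ler_powR ?nnegrE ?powR_ge0 ?subr_ge0 ?(ltW q0) ?(ltW alpha1)//.
  by rewrite (le_trans _ (ltW (refine_gt n)))// lerDl powR_ge0.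
rewrite [X in _ / X](powR_split q0) invfM -mulrA mulVKf ?gt_eqF//.
have n5 : 0 < (n + 5)%:R :> R by rewrite ltr0n addnS.
rewrite /ratio addSnnS ler_pdivrMr;
  last by apply: lt_le_trans qb; rewrite mulr_gt0.
by rewrite ler_pdivlMl// mulrC.
Qed.

Lemma period_gt0 n : 0 < period n.
Proof.
by elim: n => //= n IH; rewrite !mulr_gt0 ?ratio_gt0 ?invr_gt0 ?refine_gt0.
Qed.

Lemma rise_width_gt0 n : 0 < rise_width n.
Proof. by rewrite mulr_gt0 ?ratio_gt0 ?period_gt0. Qed.

Lemma rise_widthE n : rise_width n = (refine n)%:R * period n.+1.
Proof. by rewrite /= mulrC divfK// gt_eqF ?refine_gt0. Qed.

Lemma rise_width_le n : rise_width n <= period n.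
Proof.
rewrite ler_piMl ?(ltW (period_gt0 n))// (le_trans (ratio_le n))//; lra.
Qed.

Lemma height_gt0 n : 0 < height n.
Proof. by rewrite powR_gt0 ?rise_width_gt0. Qed.

Lemma heightE n : height n = ratio n `^ alpha * period n `^ alpha.
Proof. by rewrite /height powRM// ltW ?ratio_gt0 ?period_gt0. Qed.

Lemma height_half n : height n.+1 <= height n / 2.
Proof.
have q0 := refine_gt0 n; have d0 := period_gt0 n.+1.
have -> : height n = period n.+1 `^ alpha * (refine n)%:R `^ alpha.
  by rewrite /height rise_widthE powRM ?(ltW q0) ?(ltW d0)// mulrC.
rewrite ler_pdivlMr//.
apply: ler_pM => //; first by rewrite ltW ?height_gt0.
  by rewrite ge0_ler_powR ?nnegrE ?rise_width_le ?(ltW alpha0) ?(ltW d0)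
    ?(ltW (rise_width_gt0 _)).
exact: refine_powR.
Qed.

(** Geometric series, by [height_half]; the induction peels off the first term. *)
Lemma height_sum n k : \sum_(n <= m < n + k) height m <= 2 * height n.
Proof.
elim: k n => [|k IH] n.
  by rewrite addn0 big_geq// mulr_ge0// ltW ?height_gt0.
rewrite big_ltn ?addnS ?ltnS ?leq_addr// -addSn.
have := IH n.+1; have := height_half n; lra.
Qed.

Lemma period_le n : period n <= n.+1%:R^-1.
Proof.
elim: n => [|n IH]; first by rewrite invr1.
have d0 := period_gt0 n; have p0 := ratio_gt0 n.
have d1 : period n <= 1.
  by rewrite (le_trans IH)// invf_le1 ?ler1n// ltr0n.
apply: (@le_trans _ _ (ratio n)).
  rewrite ler_pdivrMr ?refine_gt0// ler_wpM2l ?(ltW p0)//.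
  by rewrite (le_trans d1)// ler1n.
by rewrite lef_pV2 ?posrE ?ltr0n ?addn4// ler_nat -addn4 -addn2 leq_add2l.
Qed.

(* By concavity of the power function, the bound at h = period n extends to
   all smaller h. *)
Lemma slope_sum_period n :
  slope_sum n * period n <= ratio n * period n `^ alpha ->
  forall h, 0 < h -> h <= period n -> slope_sum n * h <= ratio n * h `^ alpha.
Proof.
move=> H h h0 hd; have d0 := period_gt0 n.
have -> : slope_sum n * h = slope_sum n * period n * (h / period n).
  by rewrite mulrACA mulfV ?gt_eqF// mulr1.
apply: (@le_trans _ _ (ratio n * period n `^ alpha * (h / period n))).
  by rewrite ler_wpM2r// divr_ge0 ?ltW.
rewrite -mulrA ler_wpM2l ?(ltW (ratio_gt0 _))//.
by rewrite mulrA [leLHS]mulrAC powR_slope.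
Qed.

(** Coarser teeth are negligible up to scale [period n]. By [slope_sum_period] only [h = period n]
    needs the induction on [n]. *)
Lemma slope_sum_le n h : 0 < h -> h <= period n ->
  slope_sum n * h <= ratio n * h `^ alpha.
Proof.
move: h; apply: slope_sum_period; elim: n => [|n IH].
  by rewrite /slope_sum big_geq// mul0r mulr_ge0 ?powR_ge0// ltW ?ratio_gt0.
have l0 := rise_width_gt0 n; have q0 := refine_gt0 n.
have d0 := period_gt0 n.+1.
have h0 := height_gt0 n.
(* At scale [rise_width n] the new tooth contributes [height n], and the older ones at most
   [ratio n * height n]. Passing down to [period n.+1] then gains the factor in [refine_slope]. *)
have Sl : slope_sum n.+1 * rise_width n <= 2 * height n.
  rewrite /slope_sum big_nat_recr//= mulrDl divfK ?gt_eqF//.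
  have := slope_sum_period IH l0 (rise_width_le n).
  have := ratio_le n; have : ratio n * height n <= 1 * height n.
    by rewrite ler_wpM2r ?(ltW h0)// (le_trans (ratio_le n))//; lra.
  rewrite -/(height n) -/(slope_sum n); lra.
have -> : slope_sum n.+1 * period n.+1 =
    slope_sum n.+1 * rise_width n / (refine n)%:R.
  rewrite rise_widthE (mulrC (refine n)%:R).
  by rewrite (mulrA (slope_sum n.+1) _ (refine n)%:R) mulfK// gt_eqF.
apply: (@le_trans _ _ (2 * height n / (refine n)%:R)).
  by rewrite ler_wpM2r// invr_ge0 ltW.
rewrite /height rise_widthE powRM ?(ltW q0) ?(ltW d0)//.
by rewrite mulrA mulrAC ler_wpM2r ?powR_ge0// refine_slope.
Qed.

Lemma periodE n : period n = ((n + 4) * refine n)%:R * period n.+1.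
Proof.
rewrite natrM -mulrA -rise_widthE /rise_width mulrA mulfV ?mul1r// pnatr_eq0 addn4.
Qed.

Lemma period_dvd n k : exists j : nat, period n = j%:R * period (n + k).
Proof.
elim: k => [|k [j IH]]; first by exists 1%N; rewrite addn0 mul1r.
exists (j * ((n + k + 4) * refine (n + k)))%N.
by rewrite (addnS n k) (natrM _ j) -[RHS]mulrA -(periodE (n + k)).
Qed.

Lemma rise_width_dvd n k :
  exists j : nat, rise_width n = j%:R * period (n.+1 + k).
Proof.
have [j dj] := period_dvd n.+1 k.
by exists (refine n * j)%N; rewrite rise_widthE dj natrM mulrA.
Qed.

(** * Periodicity, size and slopes of a single tooth *)

Lemma toothDn n k x : tooth n (x + k%:R * period n) = tooth n x.
Proof. by rewrite /tooth mulrDl mulfK ?gt_eqF ?period_gt0// sawDn. Qed.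

Lemma tooth_ge0 n x : 0 <= tooth n x.
Proof.
apply: mulr_ge0; first exact: ltW (height_gt0 n).
exact: saw_ge0 (ratio_gt0 n) (ratio_le n) _.
Qed.

Lemma tooth_le n x : tooth n x <= height n.
Proof.
apply: ler_piMr; first exact: ltW (height_gt0 n).
exact: saw_le1 (ratio_gt0 n) (ratio_le n) _.
Qed.

Lemma tooth_osc n x y : `|tooth n y - tooth n x| <= height n.
Proof.
have := tooth_ge0 n x; have := tooth_le n x.
have := tooth_ge0 n y; have := tooth_le n y.
by rewrite ler_norml => *; apply/andP; split; lra.
Qed.

Lemma tooth_lipschitz n x y :
  `|tooth n y - tooth n x| <= height n / rise_width n * `|y - x|.
Proof.
have h0 := height_gt0 n; have d0 := period_gt0 n.
rewrite -mulrBr normrM gtr0_norm// -mulrA ler_wpM2l ?(ltW h0)//.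
apply: le_trans (saw_lipschitz (ratio_gt0 n) (ratio_le n) _ _) _.
rewrite -mulrBl normrM normfV (gtr0_norm d0).
by rewrite /rise_width invfM mulrA mulrAC.
Qed.

Lemma tooth_fall n x y : x <= y ->
  tooth n x - tooth n y <= 2 * (height n / period n * (y - x)).
Proof.
move=> xy; have h0 := height_gt0 n; have d0 := period_gt0 n.
have xy' : x / period n <= y / period n by rewrite ler_wpM2r// invr_ge0 ltW.
have := saw_fall (ratio_gt0 n) (ratio_le n) xy'.
rewrite -mulrBl => /(ler_wpM2l (ltW h0)); rewrite mulrBr.
by rewrite [X in _ <= X]mulrCA (mulrC (y - x)) [X in _ <= _ * X]mulrA.
Qed.

Lemma tooth_rise n (j : int) x :
  j%:~R * period n <= x < j%:~R * period n + rise_width n ->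
  tooth n (x + rise_width n) - tooth n x = height n / 2.
Proof.
have d0 := period_gt0 n.
move=> /andP[jx xj]; rewrite /tooth -mulrBr; congr (_ * _).
rewrite mulrDl {1}/rise_width mulfK ?gt_eqF// (saw_rise _ _ (k := j))//.
- exact: ratio_gt0.
- exact: ratio_le.
by rewrite ler_pdivlMr// jx/= ltr_pdivrMr// mulrDl.
Qed.

Lemma ratio_powR_small e : 0 < e ->
  exists N, forall n, (N <= n)%N -> ratio n `^ alpha <= e.
Proof.
move=> e0.
have e0' : 0 < e `^ alpha^-1 by rewrite powR_gt0.
exists (Num.truncn (e `^ alpha^-1)^-1) => n Nn.
have -> : e = (e `^ alpha^-1) `^ alpha.
  by rewrite -powRrM mulVf ?gt_eqF// powRr1// ltW.
rewrite ge0_ler_powR ?nnegrE ?(ltW alpha0) ?(ltW (ratio_gt0 n)) ?(ltW e0')//.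
rewrite invf_ple ?posrE ?ltr0n ?addn4//.
apply: le_trans (ltW (truncnS_gt _)) _.
by rewrite ler_nat !ltnS (leq_trans Nn)// -addn3 leq_addr.
Qed.

(** Take the least [n >= N] with [period n.+1 <= h]. The upper bound is the hypothesis if [n = N],
    and minimality otherwise. *)
Lemma period_bracket N h : 0 < h -> h <= period N ->
  exists2 n, (N <= n)%N & period n.+1 <= h <= period n.
Proof.
move=> h0 hN; pose P n := (N <= n)%N && (period n.+1 <= h).
have exP : exists n, P n.
  exists (maxn N (Num.truncn h^-1)); rewrite /P leq_maxl andTb.
  apply: le_trans (period_le _) _.
  rewrite invf_ple ?posrE ?ltr0n// (le_trans (ltW (truncnS_gt _)))//.
  by rewrite ler_nat ltnS (leq_trans (leq_maxr N _)).
case: (ex_minnP exP) => n /andP[Nn dh] minn.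
exists n; rewrite // dh /=.
move: Nn; rewrite leq_eqVlt => /orP[/eqP <-//|].
case: n dh minn => // n dh minn Nn.
rewrite leNgt; apply/negP => hd.
have /minn : P n by rewrite /P -ltnS Nn ltW.
by rewrite ltnn.
Qed.

(** * The sum of all teeth and its increments *)

Definition wave x : R := limn (series (tooth ^~ x)).

Lemma cvg_series_tooth x : cvgn (series (tooth ^~ x)).
Proof.
apply: nondecreasing_is_cvgn.
  apply/nondecreasing_seqP => n.
  by rewrite seriesEnat /= big_nat_recr//= lerDl tooth_ge0.
exists (2 * height 0) => _ [n _ <-]; rewrite seriesEnat/=.
have := height_sum 0 n; rewrite add0n; apply: le_trans.
by apply: ler_sum => m _; exact: tooth_le.
Qed.

(** Bounds on partial sums pass to the limit; [c] stands for the contribution of selected teeth. *)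
Lemma wave_dist_le x y c e N :
  (forall n, (N <= n)%N ->
     `|\sum_(0 <= m < n) (tooth m y - tooth m x) - c| <= e) ->
  `|wave y - wave x - c| <= e.
Proof.
move=> H.
have cv : `|series (tooth ^~ y) n - series (tooth ^~ x) n - c| @[n --> \oo] -->
    `|wave y - wave x - c|.
  apply: cvg_norm; apply: cvgB; last exact: cvg_cst.
  by apply: cvgB; exact: cvg_series_tooth.
rewrite -(cvg_lim (@Rhausdorff R) cv); apply: limr_le; first by apply: cvgP cv.
by near=> n; rewrite !seriesEnat/= -sumrB; apply: H; near: n; exact: nbhs_infty_ge.
Unshelve. all: by end_near. Qed.

Lemma tooth_sum_lipschitz n x y :
  `|\sum_(0 <= m < n) (tooth m y - tooth m x)| <= slope_sum n * `|y - x|.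
Proof.
rewrite (le_trans (ler_norm_sum _ _ _))// mulr_suml ler_sum// => m _.
exact: tooth_lipschitz.
Qed.

Lemma tooth_sum_osc n k x y :
  `|\sum_(n <= m < n + k) (tooth m y - tooth m x)| <= 2 * height n.
Proof.
rewrite (le_trans (ler_norm_sum _ _ _))// (le_trans _ (height_sum n k))//.
by rewrite ler_sum// => m _; exact: tooth_osc.
Qed.

(** Every tooth of level at least [n] has the shift as a multiple of its period, so it cancels. The
    form [<= 0] is [wave_dist_le] with zero error. *)
Lemma wave_shift n x y (j : nat) : y = x + j%:R * period n ->
  `|wave y - wave x - \sum_(0 <= m < n) (tooth m y - tooth m x)| <= 0.
Proof.
move=> yE; apply: (@wave_dist_le _ _ _ _ n) => M nM.
rewrite (big_cat_nat (leq0n _) nM)//= addrAC subrr add0r.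
rewrite big_nat_cond big1 ?normr0// => m.
rewrite andbT => /andP[nm _].
have [i dE] := period_dvd n (m - n).
by rewrite yE dE subnKC// mulrA -natrM toothDn subrr.
Qed.

Lemma wave_period n x :
  `|wave (x + period n) - wave x| <= ratio n * period n `^ alpha.
Proof.
have d0 := period_gt0 n.
have := @wave_shift n x (x + period n) 1; rewrite mul1r => /(_ erefl).
rewrite normr_le0 subr_eq0 => /eqP ->.
rewrite (le_trans (tooth_sum_lipschitz _ _ _))// addrAC subrr add0r gtr0_norm//.
exact: slope_sum_le.
Qed.

(** Tooth [n] gains [height n / 2], coarser teeth lose at most [height n / 4], and finer ones are
    unchanged since [rise_width n] is a multiple of [period n.+1]. *)
Lemma wave_rise n (i : int) x :
  i%:~R * period n <= x < i%:~R * period n + rise_width n ->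
  4^-1 * rise_width n `^ alpha <= wave (x + rise_width n) - wave x.
Proof.
move=> xi; have l0 := rise_width_gt0 n.
have [j lE] := rise_width_dvd n 0; rewrite addn0 in lE.
have := @wave_shift n.+1 x (x + rise_width n) j; rewrite {1}lE => /(_ erefl).
rewrite normr_le0 subr_eq0 => /eqP ->.
rewrite big_nat_recr//= (tooth_rise xi).
have := tooth_sum_lipschitz n x (x + rise_width n).
rewrite (addrAC x) subrr add0r (gtr0_norm l0) ler_norml => /andP[+ _].
have := slope_sum_le l0 (rise_width_le n).
have : ratio n * height n <= 4^-1 * height n.
  by rewrite ler_wpM2r ?ratio_le// ltW ?height_gt0.
rewrite -/(height n); lra.
Qed.

(** Between two consecutive periods only tooth [n] matters. In the constant 3, coarser teeth account
    for 1 by their slopes and finer ones for 2 by their heights. *)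
Lemma wave_tooth n x y : period n.+1 <= `|y - x| -> `|y - x| <= period n ->
  `|wave y - wave x - (tooth n y - tooth n x)| <=
    3 * ratio n `^ alpha * `|y - x| `^ alpha.
Proof.
move=> dh hd; set h := `|y - x|.
have d0 := period_gt0 n.+1; have h0 : 0 < h by exact: lt_le_trans dh.
have ratio_powR_ge m : ratio m <= ratio m `^ alpha.
  rewrite ger1_powR ?ratio_gt0 ?(ltW alpha1)//=.
  by rewrite (le_trans (ratio_le _))// invf_le1// ler1n.
apply: (@wave_dist_le _ _ _ _ n.+1) => M nM.
rewrite (big_cat_nat (leq0n _) nM)//= big_nat_recr//=.
have := tooth_sum_osc n.+1 (M - n.+1) x y; rewrite subnKC//.
have := tooth_sum_lipschitz n x y.
rewrite -/h => lo hi.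
have lo' : slope_sum n * h <= ratio n `^ alpha * h `^ alpha.
  apply: le_trans (slope_sum_le h0 hd) _.
  by rewrite ler_wpM2r ?powR_ge0.
have hi' : height n.+1 <= ratio n `^ alpha * h `^ alpha.
  rewrite heightE ler_pM ?powR_ge0// ge0_ler_powR ?nnegrE ?(ltW alpha0)
    ?(ltW (ratio_gt0 _)) ?(ltW d0) ?(ltW h0)//.
  by rewrite lef_pV2 ?posrE ?ltr0n ?addn4// ler_nat.
move: lo hi; rewrite !ler_norml => /andP[l1 l2] /andP[l3 l4].
apply/andP; split; lra.
Qed.

(** The constant is 3 from [wave_tooth] plus 2 from the slow descent of tooth [n]. *)
Lemma wave_fall n x h : period n.+1 <= h <= period n ->
  - (5 * ratio n `^ alpha * h `^ alpha) <= wave (x + h) - wave x.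
Proof.
move=> /andP[dh hd]; have h0 := lt_le_trans (period_gt0 n.+1) dh.
have := @wave_tooth n x (x + h).
rewrite (addrAC x) subrr add0r (gtr0_norm h0) => /(_ dh hd).
rewrite ler_norml => /andP[+ _].
have := @tooth_fall n x (x + h); rewrite lerDl (ltW h0) => /(_ isT).
rewrite (addrAC x) subrr add0r.
have : height n / period n * h <= ratio n `^ alpha * h `^ alpha.
  rewrite heightE -!mulrA ler_wpM2l ?powR_ge0// mulrA; exact: powR_slope.
lra.
Qed.

Lemma wave_holder x y : `|wave x - wave y| <= 4 * `|x - y| `^ alpha.
Proof.
rewrite distrC [in leRHS]distrC; set h := `|y - x|.
have [h0|h0] := eqVneq h 0.
  have -> : y = x by apply/eqP; rewrite -subr_eq0 -normr_eq0 -/h h0.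
  by rewrite subrr normr0 mulr_ge0 ?powR_ge0.
have {}h0 : 0 < h by rewrite lt_def h0 normr_ge0.
have [h1|h1] := leP h 1.
  have [n _ /andP[dh hd]] := @period_bracket 0 h h0 h1.
  have := wave_tooth dh hd; rewrite -/h.
  (* Below the rise width the Lipschitz bound and concavity apply; above it the height is already at
     most the power of [h]. This adds 1 to the 3 of [wave_tooth]. *)
  have : `|tooth n y - tooth n x| <= h `^ alpha.
    have [hl|lh] := leP h (rise_width n).
      by apply: le_trans (tooth_lipschitz _ _ _) _; exact: powR_slope.
    apply: le_trans (tooth_osc _ _ _) _.
    by rewrite ge0_ler_powR ?nnegrE ?(ltW alpha0) ?(ltW lh) ?(ltW h0)
      ?(ltW (rise_width_gt0 _)).
  have : ratio n `^ alpha * h `^ alpha <= h `^ alpha.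
    have one : 1 `^ alpha = 1 :> R by rewrite powR1.
    rewrite ler_piMl ?powR_ge0// -[leRHS]one.
    rewrite ge0_ler_powR ?nnegrE ?(ltW alpha0) ?(ltW (ratio_gt0 _))//.
    by rewrite (le_trans (ratio_le _))// invf_le1// ler1n.
  rewrite !ler_norml => ? /andP[? ?] /andP[? ?]; apply/andP; split; lra.
have h2 : 1 <= h `^ alpha.
  by rewrite -(powRr0 h) ler_powR// ltW.
(* For steps longer than 1 the total oscillation, at most [2 * height 0 <= 2], suffices. *)
have := @wave_dist_le x y 0 (2 * height 0) 0; rewrite subr0 => H.
apply: le_trans (H _) _.
  by move=> n _; rewrite subr0; have := tooth_sum_osc 0 n x y; rewrite add0n.
suff : height 0 <= 1 by lra.
have one : 1 `^ alpha = 1 :> R by rewrite powR1.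
rewrite /height -[leRHS]one ge0_ler_powR ?nnegrE ?(ltW alpha0)
  ?(ltW (rise_width_gt0 _))//.
exact: rise_width_le.
Qed.

(** * Almost every point rises at infinitely many levels *)

Definition rising n x := exists i : int,
  i%:~R * period n <= x < i%:~R * period n + rise_width n.

(* The part of [a, a + period n) left after deleting the initial segments of
   relative length ratio m at the levels m = n, ..., n + j - 1. *)
Fixpoint avoid j n (a : R) : set R :=
  if j is j'.+1 then
    \big[setU/set0]_(i < (n + 3) * refine n)
      avoid j' n.+1 (a + (refine n + i)%:R * period n.+1)
  else `[a, a + period n[%classic.

Lemma measurable_avoid j n a : measurable (avoid j n a).
Proof.
elim: j n a => [|j IH] n a /=; first exact: measurable_itv.
by apply: bigsetU_measurable => i _; exact: IH.
Qed.

(** Level [m] keeps the proportion [(m + 3) / (m + 4)], and the product over [j] levels telescopes.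
    Exact nesting of the cells replaces an independence argument; subadditivity is enough for the
    upper bound. *)
Lemma avoid_measure j n a :
  (lebesgue_measure (avoid j n a) <=
    (period n * (n + 3)%:R / (n + 3 + j)%:R)%:E)%E.
Proof.
elim: j n a => [|j IH] n a.
  rewrite /= lebesgue_measure_itv/= lte_fin ltrDl period_gt0 -EFinB lee_fin.
  by rewrite addn0 mulfK ?pnatr_eq0 ?addn3// addrAC subrr add0r.
pose A i := avoid j n.+1 (a + (refine n + i)%:R * period n.+1).
apply: (@le_trans _ _ (\sum_(i < (n + 3) * refine n) lebesgue_measure (A i))%E).
  by apply: Boole_inequality => i _; exact: measurable_avoid.
apply: le_trans (lee_sum _ (fun i _ => IH n.+1 _)) _.
rewrite sumEFin lee_fin sumr_const card_ord -mulr_natl.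
rewrite le_eqVlt; apply/orP; left; apply/eqP.
have -> : (n.+1 + 3 + j = n + 3 + j.+1)%N by rewrite addSn addSnnS.
have -> : (n.+1 + 3 = n + 4)%N by rewrite addSnnS.
rewrite (periodE n) !natrM.
generalize (period n.+1) ((n + 3 + j.+1)%:R^-1 : R) => u v; ring.
Qed.

Lemma mem_avoid j n (i : int) x :
  i%:~R * period n <= x < i%:~R * period n + period n ->
  (forall m, (n <= m)%N -> ~ rising m x) -> avoid j n (i%:~R * period n) x.
Proof.
elim: j n i => [|j IH] n i /andP[ix xi] nr; first by rewrite /= in_itv/= ix.
have d0 := period_gt0 n.+1.
set a := i%:~R * period n in ix xi *.
(* [k] numbers the subcell of length [period n.+1] that contains [x]. The first [refine n] subcells
   make up the deleted initial segment. *)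
pose k := Num.truncn ((x - a) / period n.+1).
have /andP[kx xk] : a + k%:R * period n.+1 <= x < a + k.+1%:R * period n.+1.
  have /truncn_itv/andP[] : 0 <= (x - a) / period n.+1.
    by rewrite divr_ge0 ?subr_ge0// ltW.
  by rewrite -/k ler_pdivlMr// ltr_pdivrMr// lerBrDl ltrBlDl => -> ->.
have kn : (k < (n + 4) * refine n)%N.
  rewrite -(ltr_nat R) -(ltr_pM2r d0) -periodE -(ltrD2l a).
  exact: le_lt_trans kx xi.
have qk : (refine n <= k)%N.
  rewrite leqNgt; apply/negP => kq; apply: (nr n (leqnn n)); exists i.
  rewrite -/a ix/= (lt_le_trans xk)// lerD2l rise_widthE.
  by rewrite ler_wpM2r ?(ltW d0)// ler_nat.
rewrite /= -(bigcup_mkord _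
  (fun l => avoid j n.+1 (a + (refine n + l)%:R * period n.+1))).
exists (k - refine n)%N; rewrite /= ?subnKC//.
  by rewrite ltn_subLR// -mulSn -addnS.
(* The subcell again starts at an integer multiple of its length, as the induction hypothesis
   requires. *)
have aE : a + k%:R * period n.+1 =
    (i * ((n + 4) * refine n)%:Z + k%:Z)%:~R * period n.+1.
  by rewrite intrD intrM /a (periodE n) mulrDl mulrA.
rewrite aE; apply: IH; last by move=> m nm; apply: nr; exact: ltnW.
by rewrite -aE kx/= (lt_le_trans xk)// -natr1 mulrDl mul1r addrA.
Qed.

Lemma negligible_not_rising N (i : int) :
  (@lebesgue_measure R).-negligible
    [set x | i%:~R * period N <= x < i%:~R * period N + period N /\
             forall n, (N <= n)%N -> ~ rising n x].
Proof.
pose B := \bigcap_j avoid j N (i%:~R * period N).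
have mB : measurable B.
  by apply: bigcapT_measurable => j; exact: measurable_avoid.
exists B; split=> //; last by move=> x [xi nr] j _; exact: mem_avoid.
apply/eqP; rewrite eq_le measure_ge0 andbT.
apply/lee_addgt0Pr => e e0; rewrite add0e.
have d0 := period_gt0 N.
(* As soon as [j] exceeds [c], the bound in [avoid_measure] is at most [e]. *)
pose c := period N * (N + 3)%:R / e.
have c0 : 0 <= c by rewrite !mulr_ge0 ?(ltW d0) ?invr_ge0 ?(ltW e0).
pose j := (Num.truncn c).+1.
apply: (@le_trans _ _ (lebesgue_measure (avoid j N (i%:~R * period N)))).
  by rewrite le_measure ?inE//; [exact: measurable_avoid|exact: bigcap_inf].
apply: le_trans (avoid_measure _ _ _) _.
rewrite lee_fin ler_pdivrMr; last by rewrite ltr0n addnS.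
rewrite [leRHS]mulrC -ler_pdivrMr// -/c; apply: le_trans (ltW (truncnS_gt c)) _.
by rewrite ler_nat leq_addl.
Qed.

Lemma ae_rising :
  {ae (@lebesgue_measure R), forall x,
    forall N, exists2 n, (N <= n)%N & rising n x}.
Proof.
pose bad N (i : int) :=
  [set x | i%:~R * period N <= x < i%:~R * period N + period N /\
             forall n, (N <= n)%N -> ~ rising n x].
(* The cells are enumerated through [unpickle]; the default 0 for non-codes only repeats a
   negligible set. *)
have neg : (@lebesgue_measure R).-negligible
    (\bigcup_N \bigcup_k bad N (odflt 0 (unpickle k : option int))).
  apply: negligible_bigcup => N; apply: negligible_bigcup => k.
  exact: negligible_not_rising.
apply: negligibleS neg => x /= /existsNP[N /forall2NP H].
exists N => //; exists (pickle (Num.floor (x / period N))) => //.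
rewrite pickleK/=; split.
  have d0 := period_gt0 N.
  have /andP[] := floor_itv (x / period N).
  by rewrite ler_pdivlMr// ltr_pdivrMr// intrD mulrDl mul1r => -> ->.
by move=> n Nn; case: (H n).
Qed.

End Scales.

(** * Criteria for upper and lower limits from the right *)

Section RightLimits.
Context {R : realType}.
Implicit Types (F : R -> R) (c r h : R).

Lemma limf_esup_at_right_ge F c :
  (forall r, 0 < r -> exists2 h, 0 < h < r & c <= F h) ->
  (c%:E <= limf_esup (fun h => (F h)%:E) 0^'+)%E.
Proof.
move=> H; apply: le_ereal_inf_tmp => _ [V /nbhs_ballP[r /= r0 rV] <-].
have [h /andP[h0 hr] cF] := H r r0.
apply: le_ereal_sup_tmp; exists (F h)%:E; last by rewrite lee_fin.
exists h => //; apply: rV => //.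
by rewrite /ball/= sub0r normrN gtr0_norm.
Qed.

(** The lower limit is the negated upper limit of the negated function. *)
Lemma limf_einf_at_right_le F c :
  (forall r, 0 < r -> exists2 h, 0 < h < r & F h <= c) ->
  (limf_einf (fun h => (F h)%:E) 0^'+ <= c%:E)%E.
Proof.
move=> H; rewrite leeNl -EFinN.
apply: (@limf_esup_at_right_ge (fun h => - F h)) => r /H[h hr Fc].
by exists h => //; rewrite lerN2.
Qed.

Lemma limf_einf_at_right_ge F c r : 0 < r ->
  (forall h, 0 < h -> h <= r -> c <= F h) ->
  (c%:E <= limf_einf (fun h => (F h)%:E) 0^'+)%E.
Proof.
move=> r0 H; rewrite limf_einfE; apply: le_ereal_sup_tmp.
exists (ereal_inf ((fun h => (F h)%:E) @` [set h | 0 < h <= r])).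
  exists [set h | 0 < h <= r] => //.
  near=> h; apply/andP; split; near: h; first exact: nbhs_right_gt.
  exact: nbhs_right_le.
by apply: le_ereal_inf_tmp => _ [h /andP[h0 hr] <-]; rewrite lee_fin H.
Unshelve. all: by end_near. Qed.

End RightLimits.

(** * The sum of teeth has the required one-sided limits *)

Unset Implicit Arguments.
Set Strict Implicit.

Theorem theorem2 (R : realType) (alpha : R) (halpha0 : 0 < alpha)
  (halpha1 : alpha < 1) :
  exists2 f : R -> R, holder_class alpha f &
    {ae (@lebesgue_measure R), forall x : R,
      (0 < limf_esup (fun h : R => (divided_difference alpha f x h)%:E) 0^'+)%E
      /\ limf_einf (fun h : R => (divided_difference alpha f x h)%:E) 0^'+
         = 0%E}.
Proof.
exists (wave alpha).
  by exists 4 => // x y; exact: wave_holder.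
have small e : 0 < e -> exists2 N, forall n, (N <= n)%N -> period alpha n < e &
    forall n, (N <= n)%N -> ratio n `^ alpha <= e :> R.
  move=> e0; have [N HN] := ratio_powR_small halpha0 e0.
  exists (maxn N (Num.truncn e^-1)) => n; rewrite geq_max => /andP[Nn en];
    last exact: HN.
  apply: le_lt_trans (period_le _ _) _.
  rewrite invf_plt ?posrE// (lt_le_trans (truncnS_gt _))// ler_nat.
  by rewrite ltnS.
apply: (negligibleS _ (ae_rising alpha)) => x /=; apply: contra_not => xr; split.
  apply: (@lt_le_trans _ _ (4^-1)%:E); first by rewrite lte_fin.
  apply: limf_esup_at_right_ge => r /small[N dr _].
  have [n Nn [i xi]] := xr N.
  have l0 := rise_width_gt0 alpha n.
  exists (rise_width alpha n).
    by rewrite l0/= (le_lt_trans (rise_width_le _ _))// dr.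
  rewrite /divided_difference gtr0_norm// ler_pdivlMr ?powR_gt0//.
  exact: wave_rise xi.
apply/eqP; rewrite eq_le; apply/andP; split.
  (* Upper bound on the lower limit: the steps [period n] give quotients at most [ratio n]. *)
  apply/lee_addgt0Pr => e e0; rewrite add0e.
  apply: limf_einf_at_right_le => r r0.
  have [N1 dr _] := small _ r0.
  have [N2 _ pe] := small _ e0.
  have d0 := period_gt0 alpha (maxn N1 N2).
  exists (period alpha (maxn N1 N2)); first by rewrite d0/= dr// leq_maxl.
  rewrite /divided_difference gtr0_norm// ler_pdivrMr ?powR_gt0//.
  rewrite (le_trans (ler_norm _))//.
  rewrite (le_trans (wave_period halpha0 halpha1 _ _))//.
  rewrite ler_wpM2r ?powR_ge0//; apply: le_trans (pe _ (leq_maxr N1 N2)).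
  (* Since the ratio is at most 1, it is at most its power [alpha], which [small] controls. *)
  rewrite ger1_powR ?ratio_gt0 ?(ltW halpha1)//=.
  by rewrite (le_trans (ratio_le _))// invf_le1// ler1n.
apply/lee_addgt0Pr => e e0; rewrite -leeBlDr// sub0e -EFinN.
(* The 5 is the constant of [wave_fall]. *)
have [N _ pe] := small (e / 5) ltac:(by rewrite divr_gt0).
apply: (@limf_einf_at_right_ge _ _ _ (period alpha N)); first exact: period_gt0.
move=> h h0 /(period_bracket h0)[n Nn dh].
rewrite /divided_difference gtr0_norm// ler_pdivlMr ?powR_gt0//.
apply: le_trans (wave_fall halpha0 halpha1 _ dh).
rewrite mulNr lerN2 ler_wpM2r ?powR_ge0//.
have := pe n Nn; lra.
Qed.
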